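(* Let $\mathbb{F}_q$ be a finite field of characteristic $2$, let $a\in\mathbb{F}_q^*$, let $b\in\mathbb{F}_q$ satisfy $b^2=a$, and let $n$ be a positive integer such that $\operatorname{rad}(n)$ divides $q-1$. Then every irreducible factor of $D_n(x,a)$ in $\mathbb{F}_q[x]$ different from $x$ has multiplicity $2$ and is of the form $$D_t(x,a)-b^t(\alpha+\alpha^{-1}),$$ where $\alpha\in\mathbb{F}_q^*$ and $t$ is a positive divisor of $\frac{n}{\gcd(n,q-1)}$ satisfying the following conditions: (i) $\alpha^{n/t}=1$; (ii) $\operatorname{rad}(t)$ divides $\operatorname{ord}_q(\alpha)$; (iii) $\gcd\left(t,\frac{q-1}{\operatorname{ord}_q(\alpha)}\right)=1$; (iv) $(\alpha,t)\neq(1,1)$.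
   Context: For $n\ge 1$ and $a\in\mathbb{F}_q$, the $n$-th Dickson polynomial of the first kind with parameter $a$ is $D_n(x,a)=\sum_{i=0}^{\lfloor n/2\rfloor}\frac{n}{n-i}\binom{n-i}{i}(-a)^i x^{n-2i}\in\mathbb{F}_q[x]$ (the numbers $\frac{n}{n-i}\binom{n-i}{i}$ are integers, viewed in $\mathbb{F}_q$). $\operatorname{rad}(n)$ is the product of the distinct primes dividing $n$, with $\operatorname{rad}(1)=1$. $\operatorname{ord}_q(\alpha)$ is the multiplicative order of $\alpha$ in the cyclic group $\mathbb{F}_q^*$. Irreducible factors are normalized to be monic. *)

(* Defs.v *)
From HB Require Import structures.
From mathcomp Require Import all_boot all_order all_algebra all_fingroup all_field.

Set Implicit Arguments.
Unset Strict Implicit.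
Unset Printing Implicit Defensive.

Import GRing.Theory.
Local Open Scope ring_scope.

(* The integer n / (n - i) * 'C(n - i, i); for 0 < n and i <= n./2 the natural
   number division is exact, see dvd_dickson_coef. *)
Definition dickson_coef (n i : nat) : nat := (n * 'C(n - i, i)) %/ (n - i).

Lemma dvd_dickson_coef (n i : nat) :
  (i <= n./2)%N -> (n - i %| n * 'C(n - i, i))%N.
Proof.
move=> le_in2.
have le_in : (i <= n)%N by apply: leq_trans le_in2 _; rewrite -divn2 leq_div.
case: i le_in2 le_in => [|i] _ le_in; first by rewrite subn0 bin0 muln1.
rewrite -[X in (_ %| X * _)%N](subnK le_in) mulnDl.
apply: dvdn_add; first exact: dvdn_mulr.
case: (n - i.+1)%N => [|m]; first by rewrite bin0n muln0.
by rewrite -mul_bin_diag dvdn_mulr.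
Qed.

(* Only meaningful for 0 < n (at n = 0 this is 0, while conventionally D_0 = 2). *)
Definition dickson (R : nzRingType) (n : nat) (a : R) : {poly R} :=
  \sum_(0 <= i < n./2.+1)
    ((dickson_coef n i)%:R * (- a) ^+ i) *: 'X^(n - i.*2).

Definition radn (n : nat) : nat := \prod_(p <- primes n) p.

Definition has_multiplicity (F : fieldType) (f p : {poly F}) (k : nat) : bool :=
  (f ^+ k %| p) && ~~ (f ^+ k.+1 %| p).

(* Main.v *)
(* Waring's identity D_n(y + u, yu) = y^n + u^n gives
   D_n(b (w + 1/w), b^2) = b^n (w^n + w^-n), so the nonzero roots of D_n(x, b^2)
   are the b (w + 1/w) with w^n = 1, w <> 1.  Here n is odd, as 2 does not divide
   q - 1, so in characteristic 2 D_n(x, b^2) = x H^2 where H has degree (n - 1)/2;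
   counting roots shows that H is separable, hence the multiplicity 2.
   If f has the root b (w + 1/w) with w of order m | n, set t = m / gcd(m, q - 1)
   and alpha = w^t, which lies in F.  Then f divides the monic polynomial
   D_t(x, a) - b^t (alpha + 1/alpha) of degree t.  If d = deg f, the Frobenius of
   F_(q^d) sends w to w or 1/w, so m divides q^(2d) - 1; lifting the exponent
   turns this into t | 2d, and t is odd, so t | d and f is that polynomial. *)
Require Import Defs.
From HB Require Import structures.
From mathcomp Require Import all_boot all_order all_algebra all_fingroup all_field.
From mathcomp Require Import cyclic separable ring.

Set Implicit Arguments.
Unset Strict Implicit.
Unset Printing Implicit Defensive.

Import GRing.Theory.
Local Open Scope ring_scope.

(** * Recurrence and Waring's identity for Dickson polynomials *)

Lemma dickson_coefn0 (n : nat) : (0 < n)%N -> dickson_coef n 0 = 1%N.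
Proof. by move=> n_gt0; rewrite /dickson_coef subn0 bin0 muln1 divnn n_gt0. Qed.

Lemma dickson_coef_small (n i : nat) : (n < i.*2)%N -> dickson_coef n i = 0%N.
Proof.
move=> lt_n2i; case: (posnP (n - i)) => [le_ni | lt_in].
  by rewrite /dickson_coef le_ni divn0.
rewrite /dickson_coef bin_small ?muln0 ?div0n //.
by rewrite ltn_subLR ?addnn // ltnW // -subn_gt0.
Qed.

(** Splitting the factor m + (i + 1) and absorbing (i + 1) C(m, i + 1) = m C(m - 1, i) makes the
    division by m exact. In this division-free form the recurrence below is Pascal's rule. *)
Lemma dickson_coef_addS (m i : nat) :
  (0 < m)%N -> dickson_coef (m + i.+1) i.+1 = ('C(m, i.+1) + 'C(m.-1, i))%N.
Proof.
case: m => // m _; rewrite /dickson_coef addnK mulnDl -mul_bin_diag -mulnDr.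
by rewrite mulKn.
Qed.

Lemma dickson_coefS (n i : nat) :
  (i < n)%N ->
  dickson_coef n.+2 i.+1 = (dickson_coef n.+1 i.+1 + dickson_coef n i)%N.
Proof.
move=> lt_in; have [m m_gt0 def_n] : exists2 m, (0 < m)%N & n = (m + i)%N.
  by exists (n - i)%N; rewrite ?subn_gt0 // subnK // ltnW.
have -> : n.+2 = (m.+1 + i.+1)%N by rewrite def_n addSn addnS.
have -> : n.+1 = (m + i.+1)%N by rewrite def_n addnS.
rewrite !dickson_coef_addS // def_n /= -addnA binS -addnA; congr (_ + _)%N.
case: i m m_gt0 {lt_in def_n} => [|i] [|m] // _.
  by rewrite !bin0 dickson_coefn0 ?addn0.
by rewrite dickson_coef_addS //= {1}binS addnAC -addnA.
Qed.

(** Lets Dickson polynomials of different index be summed over a common range; in the added terms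
    the exponent truncates to 0, but the coefficient vanishes. *)
Lemma dickson_widen (R : nzRingType) (a : R) (n N : nat) :
  (n./2 < N)%N ->
  dickson n a =
    \sum_(0 <= i < N) ((dickson_coef n i)%:R * (- a) ^+ i) *: 'X^(n - i.*2).
Proof.
move=> lt_nN; rewrite (big_cat_nat (n := n./2.+1)) //= [X in _ + X]big1_seq ?addr0 //.
move=> i; rewrite mem_index_iota => /and3P[_ lt_ni _].
by rewrite dickson_coef_small ?mul0r ?scale0r // -ltn_half_double.
Qed.

Lemma dickson1 (R : nzRingType) (a : R) : dickson 1 a = 'X.
Proof. by rewrite /dickson big_nat1 dickson_coefn0 // mulr1 scale1r. Qed.

Lemma dickson2 (R : nzRingType) (a : R) : dickson 2 a = 'X^2 - (2%:R * a)%:P.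
Proof.
rewrite /dickson unlock /= dickson_coefn0 // mulr1 scale1r addr0 expr0 expr1.
by rewrite mulrN scaleNr alg_polyC.
Qed.

(** At n = 0 the recurrence would need D_0 = 2, whereas [dickson 0 a] is 0; hence inductions start
    from the indices 1 and 2. *)
Lemma dicksonSS (R : comNzRingType) (a : R) (n : nat) : (0 < n)%N ->
  dickson n.+2 a = 'X * dickson n.+1 a - a *: dickson n a.
Proof.
move=> n_gt0; rewrite (@dickson_widen _ a n.+2 n./2.+2) //.
rewrite (@dickson_widen _ a n.+1 n./2.+2);
  last exact: (half_leq (leqnSn n.+1)).
rewrite /dickson !(big_nat_recl n./2.+1) //= !dickson_coefn0 // mulrDr -addrA.
rewrite !expr0 !mulr1 !scale1r !subn0 -exprS; congr (_ + _).
rewrite mulr_sumr scaler_sumr -sumrB; apply: eq_big_nat => i /= lt_in.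
have le_2in : (i.*2 <= n)%N by rewrite leqNgt -ltn_half_double -leqNgt -ltnS.
have lt_in' : (i < n)%N.
  by case: i le_2in {lt_in} => // i; apply: leq_trans; rewrite doubleS !ltnS -addnn leq_addl.
rewrite dickson_coefS // natrD mulrDl scalerDl !subSS; congr (_ + _).
  (* If 2i = n, the truncated exponent n - (2i + 1) is off by one, but its coefficient is zero. *)
  case: (ltngtP i.*2 n) le_2in => // [lt_2in _ | eq_n _].
    by rewrite -scalerAr -exprS subnSK.
  by rewrite dickson_coef_small ?mul0r ?scale0r ?mulr0 // -eq_n doubleS.
rewrite scalerA -scaleNr; congr (_ *: _).
by rewrite exprS mulrCA mulNr.
Qed.

Lemma pos_nat_ind2 (P : nat -> Prop) :
  P 1%N -> P 2%N -> (forall n, (0 < n)%N -> P n -> P n.+1 -> P n.+2) ->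
  forall n, (0 < n)%N -> P n.
Proof.
move=> P1 P2 PSS; case=> // n _.
suff [] : P n.+1 /\ P n.+2 by [].
by elim: n => // n [Pn PSn]; split=> //; apply: PSS.
Qed.

Lemma dickson_monic (R : comNzRingType) (a : R) (n : nat) : (0 < n)%N ->
  dickson n a \is monic /\ size (dickson n a) = n.+1.
Proof.
elim/pos_nat_ind2: n / => [||n n_gt0 [mon_n sz_n] [mon_Sn sz_Sn]].
- by rewrite dickson1 monicX size_polyX.
- rewrite dickson2; have lt_sz : (size (- (2%:R * a)%:P : {poly R}) < size ('X^2 : {poly R}))%N.
    by rewrite size_polyN size_polyXn (leq_ltn_trans (size_polyC_leq1 _)).
  by rewrite monicE lead_coefDl // lead_coefXn size_polyDl // size_polyXn.
have lt_sz : (size (- (a *: dickson n a)) < size ('X * dickson n.+1 a)%R)%N.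
  rewrite size_polyN [_ * dickson n.+1 a]mulrC size_mulX ?monic_neq0 // sz_Sn.
  by rewrite (leq_ltn_trans (size_scale_leq _ _)) // sz_n.
rewrite dicksonSS // monicE lead_coefDl // size_polyDl //.
by rewrite [_ * dickson n.+1 a]mulrC lead_coefMX size_mulX ?monic_neq0 // sz_Sn (eqP mon_Sn).
Qed.

(** Both sides satisfy the linear recurrence with characteristic roots y and u. *)
Lemma dickson_waring (R : comNzRingType) (y u : R) (n : nat) : (0 < n)%N ->
  (dickson n (y * u)).[y + u] = y ^+ n + u ^+ n.
Proof.
elim/pos_nat_ind2: n / => [||n n_gt0 IHn IHSn].
- by rewrite dickson1 hornerX.
- by rewrite dickson2 hornerD hornerN hornerC hornerXn; ring.
by rewrite dicksonSS // hornerD hornerN hornerM hornerX hornerZ IHn IHSn !exprS; ring.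
Qed.

Lemma map_dickson (R S : nzRingType) (phi : {rmorphism R -> S}) (n : nat) (a : R) :
  map_poly phi (dickson n a) = dickson n (phi a).
Proof.
rewrite /dickson rmorph_sum; apply: eq_bigr => i _ /=.
by rewrite map_polyZ map_polyXn rmorphM rmorph_nat rmorphXn rmorphN.
Qed.

(** * Lifting the exponent, gcds and radicals *)

(** Modulo p^2 the sum is p + C(p, 2) p k, and p divides C(p, 2) because p is odd. *)
Lemma geometric_sum_modn_sq (p k : nat) : odd p ->
  exists c, (\sum_(i < p) (1 + p * k) ^ i = p * (1 + p * c))%N.
Proof.
move=> odd_p.
have expE i : exists c, ((1 + p * k) ^ i = 1 + i * (p * k) + p * p * c)%N.
  elim: i => [|i [c IHi]]; first by exists 0%N; rewrite muln0.
  exists (c + c * (p * k) + i * k * k)%N; rewrite expnS IHi; ring.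
have sumE j : exists c,
    (\sum_(i < j) (1 + p * k) ^ i = j + 'C(j, 2) * (p * k) + p * p * c)%N.
  elim: j => [|j [c IHj]]; first by exists 0%N; rewrite big_ord0 muln0.
  have [d Ed] := expE j; exists (c + d)%N.
  by rewrite big_ord_recr /= IHj Ed binS bin1; ring.
have [c ->] := sumE p; exists (p.-1./2 * k + c)%N.
by rewrite bin2odd //; ring.
Qed.

Lemma geometric_sum_modn (q r e : nat) :
  (q = 1 %[mod r])%N -> (\sum_(i < e) q ^ i = e %[mod r])%N.
Proof.
move=> q1; rewrite -modn_summ (eq_bigr (fun=> 1 %% r)%N) => [|i _].
  by rewrite modn_summ sum1_card card_ord.
by rewrite -modnXm q1 modnXm exp1n.
Qed.

Lemma eqn_mod1_predn (q r : nat) :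
  (0 < q)%N -> (r %| q.-1)%N -> (q = 1 %[mod r])%N.
Proof.
by move=> q_gt0 dv; apply/eqP; rewrite eqn_mod_dvd // subn1.
Qed.

Lemma coprime_no_common_prime (m n : nat) : (0 < m)%N ->
  (forall r, prime r -> (r %| m)%N -> (r %| n)%N -> False) -> coprime m n.
Proof.
move=> m_gt0 noP; apply: contraPT isT => nco.
have g_gt1 : (1 < gcdn m n)%N by rewrite ltn_neqAle eq_sym nco gcdn_gt0 m_gt0.
have /andP[] : (pdiv (gcdn m n) %| m)%N && (pdiv (gcdn m n) %| n)%N.
  by rewrite -dvdn_gcd pdiv_dvd.
by move=> r_m r_n; case: (noP _ (pdiv_prime g_gt1) r_m r_n).
Qed.

(* A weak form of "lifting the exponent": at each odd prime r dividing both m and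
   q - 1, the r-adic valuation of q^e - 1 is that of (q - 1) e. *)
Lemma dvdn_predn_exp (q m e : nat) : (0 < q)%N -> odd m ->
  (forall r, prime r -> (r %| m)%N -> (r %| q.-1)%N) ->
  (m %| (q ^ e).-1)%N -> (m %| q.-1 * e)%N.
Proof.
move=> q_gt0; have [s] := ubnP e; elim: s e m => // s IHs [|e'] m.
  by rewrite muln0 dvdn0.
set e := e'.+1 => lt_es odd_m pr_m dv_m.
have m_gt0 : (0 < m)%N by case: m odd_m {pr_m dv_m}.
(* If m is coprime to e: the cofactor of q - 1 in q^e - 1 is e modulo each prime r dividing m, so it
   is coprime to m and m divides q - 1. *)
have [co_me | nco_me] := boolP (coprime m e).
  apply: dvdn_mulr; move: dv_m; rewrite predn_exp Gauss_dvdl //.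
  apply: coprime_no_common_prime => // r r_pr r_m r_S.
  have := geometric_sum_modn e (eqn_mod1_predn q_gt0 (pr_m r r_pr r_m)).
  move/eqP: r_S => -> /esym/eqP r_e.
  have: (r %| gcdn m e)%N by rewrite dvdn_gcd r_m.
  by rewrite (eqP co_me) Euclid_dvd1.
pose p := pdiv (gcdn m e).
have g_gt1 : (1 < gcdn m e)%N.
  by rewrite ltn_neqAle eq_sym nco_me gcdn_gt0 m_gt0.
have p_pr : prime p := pdiv_prime g_gt1.
have /andP[] : (p %| m)%N && (p %| e)%N by rewrite -dvdn_gcd pdiv_dvd.
case/dvdnP=> m' def_m /dvdnP[d def_e].
have p_gt0 := prime_gt0 p_pr.
have d_gt0 : (0 < d)%N by case: d def_e.
have Q_gt0 : (0 < q ^ d)%N by rewrite expn_gt0 q_gt0.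
have q1_Q : (q.-1 %| (q ^ d).-1)%N by rewrite predn_exp dvdn_mulr.
have odd_p : odd p by move: odd_m; rewrite def_m oddM => /andP[].
have odd_m' : odd m' by move: odd_m; rewrite def_m oddM => /andP[].
have m'_m : (m' %| m)%N by rewrite def_m dvdn_mulr.
have m'_gt0 : (0 < m')%N by rewrite odd_gt0.
have pr_m' r : prime r -> (r %| m')%N -> (r %| q.-1)%N.
  by move=> r_pr r_m'; apply: pr_m => //; apply: dvdn_trans m'_m.
have p_q1 : (p %| q.-1)%N by apply: pr_m => //; rewrite def_m dvdn_mull.
have [k def_k] := dvdnP (dvdn_trans p_q1 q1_Q).
have def_Q : (q ^ d = 1 + p * k)%N by rewrite mulnC -def_k add1n prednK.
have [c def_S] := geometric_sum_modn_sq k odd_p.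
rewrite def_m def_e mulnA dvdn_pmul2r //; apply: IHs => //.
  by rewrite -ltnS (leq_trans _ lt_es) // ltnS def_e ltn_Pmulr ?prime_gt1.
(* With Q = q^d, q^e - 1 = (Q - 1) p (1 + p c). Cancelling p leaves m' | (Q - 1)(1 + p c), and m' is
   shown coprime to the last factor. *)
move: dv_m; rewrite def_m def_e expnM predn_exp def_Q def_S -def_Q.
rewrite [(p * _)%N]mulnC mulnA dvdn_pmul2r // Gauss_dvdl //.
apply: coprime_no_common_prime => // r r_pr r_m' r_S.
have Q1 := eqn_mod1_predn Q_gt0 (dvdn_trans (pr_m' r r_pr r_m') q1_Q).
(* The sum p (1 + p c) is p modulo r, so r | 1 + p c would force r = p, and then p | 1. *)
have := geometric_sum_modn p Q1; rewrite {1}def_Q def_S => /eqP.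
rewrite -modnMmr (eqP r_S) muln0 mod0n eq_sym => r_p.
have {}r_p : r = p by apply/eqP; rewrite -dvdn_prime2.
by move: r_S; rewrite r_p dvdn_addl ?dvdn_mulr // Euclid_dvd1.
Qed.

(** Multiplied by k, both sides become lcms with k, and the lcm is monotone for divisibility. *)
Lemma dvdn_div_gcd (m n k : nat) : (0 < k)%N ->
  (m %| n)%N -> (m %/ gcdn m k %| n %/ gcdn n k)%N.
Proof.
move=> k_gt0 mn.
have lcm_div i : (i %/ gcdn i k * k = lcmn i k)%N.
  by rewrite divn_mulAC ?dvdn_gcdl.
rewrite -(dvdn_pmul2r k_gt0) !lcm_div dvdn_lcm dvdn_lcmr andbT.
by apply: dvdn_trans mn _; apply: dvdn_lcml.
Qed.

Lemma prime_dvd_radn (n p : nat) : prime p -> (0 < n)%N -> (p %| n)%N -> (p %| radn n)%N.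
Proof.
move=> p_pr n_gt0 p_n; rewrite /radn (big_rem p) ?dvdn_mulr //=.
by rewrite mem_primes p_pr n_gt0.
Qed.

Lemma radn_dvd (n g : nat) :
  (forall p, prime p -> (p %| n)%N -> (p %| g)%N) -> (radn n %| g)%N.
Proof.
move=> dv_g; rewrite /radn.
have: all (fun p => prime p && (p %| g)%N) (primes n).
  by apply/allP=> p; rewrite mem_primes => /and3P[p_pr _ /(dv_g _ p_pr)->]; rewrite p_pr.
elim: (primes n) (primes_uniq n) => [|p s IHs] /=; first by rewrite big_nil.
case/andP=> p_s uniq_s /andP[/andP[p_pr p_g] all_s].
rewrite big_cons Gauss_dvd ?p_g ?IHs // big_seq.
elim/big_ind: _ => [|x y px py|r r_s]; rewrite ?coprimen1 ?coprimeMr ?px //.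
have /andP[r_pr _] := allP all_s _ r_s.
rewrite prime_coprime // dvdn_prime2 //.
by apply: contraNneq p_s => ->.
Qed.

(** * The square factor in characteristic 2 and its roots *)

(** The H of D_n(x, b^2) = x H^2 for n = 2k + 1 in characteristic 2. *)
Definition dickson_sqrt (R : nzRingType) (k : nat) (b : R) : {poly R} :=
  \sum_(0 <= i < k.+1) ((dickson_coef k.*2.+1 i)%:R * b ^+ i) *: 'X^(k - i).

Lemma map_dickson_sqrt (R S : nzRingType) (phi : {rmorphism R -> S}) (k : nat)
    (b : R) :
  map_poly phi (dickson_sqrt k b) = dickson_sqrt k (phi b).
Proof.
rewrite /dickson_sqrt rmorph_sum; apply: eq_bigr => i _ /=.
by rewrite map_polyZ map_polyXn rmorphM rmorph_nat rmorphXn.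
Qed.

(** Frobenius squares H term by term and fixes the integer coefficients; signs disappear. *)
Lemma dickson_odd_char2 (R : comNzRingType) (k : nat) (b : R) :
  2%N \in [pchar R] ->
  dickson k.*2.+1 (b ^+ 2) = 'X * dickson_sqrt k b ^+ 2.
Proof.
move=> char2; have char2P : 2%N \in [pchar {poly R}].
  exact: (rmorph_pchar (@polyC R)).
rewrite -(pFrobenius_autE char2P) rmorph_sum mulr_sumr.
rewrite (@dickson_widen _ _ _ k.+1) ?ltnS ?[_./2]uphalf_double //.
apply: eq_big_nat => i /=; rewrite ltnS => le_ik; rewrite pFrobenius_autE exprZn exprMn.
rewrite -[_%:R ^+ 2](pFrobenius_autE char2) pFrobenius_aut_nat oppr_pchar2 // exprAC.
by rewrite -scalerAr -['X^_ ^+ 2]exprM -exprS muln2 doubleB subSn // leq_double.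
Qed.

(** Read off from x H^2 = D_n: the leading coefficient squares to 1, so it is 1 in characteristic
    2. *)
Lemma dickson_sqrt_monic (F : fieldType) (k : nat) (b : F) : 2%N \in [pchar F] ->
  dickson_sqrt k b \is monic /\ size (dickson_sqrt k b) = k.+1.
Proof.
move=> char2; have [//|mon_D sz_D] := @dickson_monic _ (b ^+ 2) k.*2.+1.
have D_neq0 := monic_neq0 mon_D; move: mon_D sz_D D_neq0.
rewrite dickson_odd_char2 // monicMl ?monicX // expr2 !mulf_eq0 !negb_or.
rewrite !monicE lead_coefM -expr2 sqrf_eq1 oppr_pchar2 // orbb.
move=> lead1 szX /andP[X0 /andP[H0 _]]; split=> //; move: szX.
rewrite !size_mul ?mulf_neq0 // size_polyX; case: (size _) => // s.
by rewrite /= addSn addnS /= addnn => -[/double_inj->].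
Qed.

Lemma add_inv_inj (F : fieldType) (x y : F) : x != 0 -> y != 0 ->
  x + x^-1 = y + y^-1 -> x = y \/ x * y = 1.
Proof.
move=> x0 y0 eq_xy.
have /eqP : (x - y) * (x * y - 1) = 0.
  have -> : (x - y) * (x * y - 1) = x * y * ((x + x^-1) - (y + y^-1)).
    by field; rewrite x0 y0.
  by rewrite eq_xy subrr mulr0.
by rewrite mulf_eq0 !subr_eq0 => /orP[/eqP|/eqP]; [left | right].
Qed.

Lemma dickson_add_inv (F : fieldType) (b z : F) (n : nat) : (0 < n)%N ->
  z != 0 ->
  (dickson n (b ^+ 2)).[b * (z + z^-1)] = b ^+ n * (z ^+ n + (z ^+ n)^-1).
Proof.
move=> n_gt0 z0; have -> : b ^+ 2 = (b * z) * (b * z^-1) by field.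
by rewrite mulrDr dickson_waring // !exprMn exprVn mulrDr.
Qed.

(** The exponents 1, ..., k pick one of each pair z^i, z^-i: two of them sum to less than n. This
    gives k distinct roots, as many as the degree. *)
Lemma dickson_sqrt_roots (F : fieldType) (k : nat) (b z : F) :
    2%N \in [pchar F] -> b != 0 -> k.*2.+1.-primitive_root z ->
  let rs := [seq b * (z ^+ i + (z ^+ i)^-1) | i <- iota 1 k] in
  uniq rs /\ dickson_sqrt k b = \prod_(x <- rs) ('X - x%:P).
Proof.
move=> char2 b0 prim_z rs; set n := k.*2.+1 in prim_z.
have zi0 i : z ^+ i != 0 by rewrite expf_neq0 // (prim_root_eq0 prim_z).
have zn1 i : (0 < i < n)%N -> z ^+ i != 1.
  by case/andP=> i_gt0 lt_in; rewrite -(prim_order_dvd prim_z) gtnNdvd.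
have uniq_rs : uniq rs.
  rewrite map_inj_in_uniq ?iota_uniq // => i j.
  rewrite !mem_iota !add1n !ltnS => /andP[i_gt0 le_ik] /andP[j_gt0 le_jk].
  case/(mulfI b0)/add_inv_inj => // /eqP.
    rewrite (eq_prim_root_expr prim_z) !modn_small; first by move/eqP.
      by rewrite ltnS (leq_trans le_jk) // -addnn leq_addl.
    by rewrite ltnS (leq_trans le_ik) // -addnn leq_addl.
  rewrite -exprD (negPf (zn1 _ _)) // addn_gt0 i_gt0 /= ltnS -addnn.
  exact: leq_add.
split=> //; have [mon_H sz_H] := dickson_sqrt_monic k b char2.
have := @all_roots_prod_XsubC _ (dickson_sqrt k b) rs.
rewrite (eqP mon_H) scale1r; apply.
- by rewrite sz_H size_map size_iota.
- apply/allP=> x /mapP[i]; rewrite mem_iota add1n ltnS => /andP[i_gt0 le_ik] ->.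
  have := dickson_add_inv b (isT : (0 < n)%N) (zi0 i).
  rewrite exprAC (prim_expr_order prim_z) expr1n invr1.
  rewrite (addrr_pchar2 char2) mulr0 dickson_odd_char2 // hornerM hornerX.
  rewrite horner_exp => /eqP; rewrite mulf_eq0 expf_eq0 /= => /orP[|//].
  (* The value is a root of x H^2; were it 0, then z^i = z^-i and z^(2i) = 1, although 0 < 2i <
     n. *)
  rewrite mulf_eq0 (negPf b0) /= addr_eq0 oppr_pchar2 // => /eqP zi_V.
  have: z ^+ (i + i) != 1.
    by rewrite zn1 // addn_gt0 i_gt0 ltnS -addnn leq_add.
  by rewrite exprD {1}zi_V mulVf ?eqxx.
- by rewrite uniq_rootsE.
Qed.

(** * Roots of unity and irreducible polynomials over finite fields *)

Lemma closed_prim_root (L : closedFieldType) (n : nat) : n%:R != 0 :> L ->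
  exists z : L, n.-primitive_root z.
Proof.
move=> n0; have n_gt0 : (0 < n)%N by case: n n0; rewrite ?eqxx.
have mon : ('X^n - 1 : {poly L}) \is monic by rewrite monicXnsubC.
have [rs def_rs] := closed_field_poly_normal ('X^n - 1 : {poly L}).
move: def_rs; rewrite (eqP mon) scale1r => def_rs.
have /hasP[z _ prim_z] : has n.-primitive_root rs; last by exists z.
apply: has_prim_root => //.
- apply/allP=> x x_rs; rewrite unity_rootE.
  have: root ('X^n - 1) x by rewrite def_rs root_prod_XsubC.
  by rewrite rootE !hornerE subr_eq0.
- by rewrite -separable_prod_XsubC -def_rs separable_Xn_sub_1.
- by rewrite -ltnS -(size_prod_XsubC rs id) -def_rs size_XnsubC.
Qed.

(** The class of X lies in F[X]/(f), a field with q^deg(f) elements. *)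
Lemma irreducible_dvdp_XcardX (F : finFieldType) (f : {poly F}) :
    irreducible_poly f -> f \is monic ->
  f %| 'X^(#|F| ^ (size f).-1) - 'X.
Proof.
move=> irr_f mon_f; have hI : monic_irreducible_poly f by [].
have eq_f : mk_monic f = f by rewrite /mk_monic irr_f mon_f.
have := expf_card (in_qpoly f 'X : {poly %/ f with hI}).
rewrite card_qfpoly -rmorphXn /= => eq_X.
have /(congr1 val) /= : in_qpoly f ('X^(#|F| ^ (size f).-1) - 'X) = 0.
  by rewrite raddfB /= eq_X subrr.
by rewrite eq_f dvdpE /Pdiv.Ring.rdvdp => ->.
Qed.

Lemma irreducible_dvdp_exp (F : fieldType) (f g : {poly F}) (k : nat) :
  irreducible_poly f -> (0 < k)%N -> (f %| g ^+ k) = (f %| g).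
Proof.
move=> irr_f k_gt0; apply: negb_inj.
by rewrite -!irreducible_poly_coprime // coprimep_pexpr.
Qed.

(** With h = g f, f^3 | X h^2 would give f | g^2, hence f | g and f^2 | h, against separability. *)
Lemma multiplicity_X_sqr (F : fieldType) (f h : {poly F}) :
    irreducible_poly f -> coprimep f 'X -> separable_poly h ->
  f %| h -> has_multiplicity f ('X * h ^+ 2) 2.
Proof.
move=> irr_f co_fX sep_h /dvdpP[g def_h]; apply/andP; split.
  by rewrite dvdp_mull // dvdp_exp2r // def_h dvdp_mull.
have f0 : f != 0 by rewrite -size_poly_gt0 (ltn_trans _ irr_f.1).
rewrite Gauss_dvdpr ?coprimep_expl // def_h exprMn exprS mulrC.
rewrite [g ^+ 2 * _]mulrC dvdp_mul2l ?expf_neq0 // irreducible_dvdp_exp //.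
apply/negP=> /dvdpP[u def_g].
have := @separable_nosquare _ h f 2 sep_h isT.
rewrite gtn_eqF ?irr_f.1 // => /(_ isT).
by rewrite def_h def_g -mulrA -expr2 dvdp_mull.
Qed.

Lemma irreducible_dvdp_root (F L : fieldType) (iota : {rmorphism F -> L})
    (f p : {poly F}) (x : L) :
  irreducible_poly f -> root (map_poly iota f) x -> root (map_poly iota p) x ->
  f %| p.
Proof.
move=> irr_f f_x p_x; apply: contraLR p_x.
rewrite -irreducible_poly_coprime // -(coprimep_map iota) => co.
exact: coprimep_root co f_x.
Qed.

Lemma finField_image (F : finFieldType) (L : fieldType)
    (iota : {rmorphism F -> L}) (x : L) :
  x ^+ #|F| = x -> exists a : F, x = iota a.
Proof.
move=> x_q; have := congr1 (map_poly iota) (finField_genPoly F).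
rewrite rmorphB /= map_polyXn map_polyX rmorph_prod /= => eq_p.
have: root ('X^#|F| - 'X) x by rewrite rootE !hornerE x_q subrr.
rewrite eq_p.
rewrite (eq_bigr (fun a => 'X - (iota a)%:P)) => [|a _]; last first.
  by rewrite /= rmorphB /= map_polyX map_polyC.
rewrite -(big_map iota xpredT (fun y => 'X - y%:P)) root_prod_XsubC.
by case/mapP=> a _ ->; exists a.
Qed.

Lemma finField_card_pnat2 (F : finFieldType) : 2%N \in [pchar F] -> (2.-nat #|F|)%N.
Proof.
move=> char2; have := card_pprimeChar char2.
(* [pPrimeCharType] is F seen as a vector space over its prime field, with the same elements. *)
have <- : #|F| = #|pPrimeCharType char2|.
  by apply: (@bij_eq_card F (pPrimeCharType char2) id); exists id.
move=> ->.
by rewrite pnatX.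
Qed.

Lemma coprime_div_gcd (m k : nat) : (0 < k)%N ->
  coprime (m %/ gcdn m k) (k %/ gcdn m k).
Proof.
move=> k_gt0; have g_gt0 : (0 < gcdn m k)%N by rewrite gcdn_gt0 k_gt0 orbT.
rewrite /coprime -(eqn_pmul2r g_gt0) muln_gcdl !divnK ?dvdn_gcdl ?dvdn_gcdr //.
by rewrite mul1n.
Qed.

(* x = b (w + 1/w) satisfies x^Q = x for Q = q^d, so w^Q is w or 1/w; hence w has
   order dividing Q^2 - 1, and m / gcd(m, q - 1) divides 2d. *)
Lemma dvdn_prim_root_degree (L : fieldType) (q d m : nat) (b w : L) :
    2%N \in [pchar L] -> (2.-nat q)%N -> (0 < d)%N -> b != 0 -> b ^+ q = b ->
    odd m -> m.-primitive_root w ->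
    (forall p, prime p -> (p %| m)%N -> (p %| q.-1)%N) ->
    (b * (w + w^-1)) ^+ (q ^ d) = b * (w + w^-1) ->
  (m %/ gcdn m q.-1 %| d)%N.
Proof.
move=> char2 q2 d_gt0 b0 b_q odd_m prim_w pr_m x_Q.
have w0 : w != 0 by rewrite (prim_root_eq0 prim_w) -lt0n odd_gt0.
have q_gt0 : (0 < q)%N by case/andP: q2.
have Q_gt0 : (0 < q ^ d)%N by rewrite expn_gt0 q_gt0.
have b_Q : b ^+ (q ^ d) = b.
  by elim: (d) => [|e IHe]; rewrite ?expr1 // expnS exprM b_q.
have pchar_Q : [pchar L].-nat (q ^ d)%N.
  by rewrite (eq_pnat _ (pcharf_eq char2)) pnatX q2.
have m_Q2 : (m %| (q ^ (d * 2)).-1)%N.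
  (* Q^2 - 1 = (Q - 1)(1 + Q): the case w^Q = w uses the first factor, w^Q = 1/w the second. *)
  rewrite expnM predn_exp !big_ord_recl big_ord0 expn0 expn1 addn0 add1n.
  rewrite (prim_order_dvd prim_w).
  move: x_Q; rewrite exprMn b_Q => /(mulfI b0).
  rewrite exprDn_pchar // exprVn => /add_inv_inj[]; rewrite ?expf_neq0 //.
    move=> w_Q; rewrite exprM.
    suff ->: w ^+ (q ^ d).-1 = 1 by rewrite expr1n.
    by apply: (mulfI w0); rewrite -exprS prednK // w_Q mulr1.
  by move=> w_Q; rewrite mulnC exprM exprSr w_Q expr1n.
(* For q = 1 the gcd is m itself and the quotient is 1. *)
have q1_gt0 : (0 < q.-1)%N || (q == 1%N) by case: (q) q_gt0 => [|[]].
case/orP: q1_gt0 => [q1_gt0|/eqP q1]; last first.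
  rewrite q1 gcdn0 divnn odd_gt0 //.
have := dvdn_predn_exp q_gt0 odd_m pr_m m_Q2.
set g := gcdn m q.-1; have g_gt0 : (0 < g)%N by rewrite gcdn_gt0 q1_gt0 orbT.
have odd_t : odd (m %/ g).
  by have := odd_m; rewrite -{1}(divnK (dvdn_gcdl m q.-1)) oddM => /andP[].
(* Cancel g in t g | (q - 1) 2d; then t is coprime to (q - 1)/g and, being odd, to 2. *)
rewrite -{1}(divnK (dvdn_gcdl m q.-1)) -{3}(divnK (dvdn_gcdr m q.-1)).
rewrite -/g mulnAC dvdn_pmul2r // Gauss_dvdr ?coprime_div_gcd // Gauss_dvdl //.
by rewrite coprimen2.
Qed.

Lemma order_unit_val (F : finFieldType) (L : fieldType)
    (iota : {rmorphism F -> L}) (alpha : {unit F}) (g : nat) :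
  g.-primitive_root (iota (val alpha)) -> #[alpha]%g = g.
Proof.
move=> prim; apply/eqP; rewrite eqn_dvd.
have val1 i : (alpha ^+ i == 1)%g = (iota (val alpha) ^+ i == 1).
  by rewrite -val_eqE /= FinRing.val_unitX -rmorphXn fmorph_eq1.
rewrite order_dvdn val1 -!(prim_order_dvd prim) dvdnn /=.
by rewrite (prim_order_dvd prim) -val1 expg_order.
Qed.

(** * Irreducible factors of the Dickson polynomial *)

Theorem theorem5p2 (F : finFieldType) (hchar : 2%N \in [pchar F])
  (a b : F) (ha : a != 0) (hb : b ^+ 2 = a)
  (n : nat) (hn : (0 < n)%N) (hrad : (radn n %| #|F| - 1)%N)
  (f : {poly F}) (hmonic : f \is monic) (hirr : irreducible_poly f)
  (hfact : f %| dickson n a) (hX : f <> 'X) :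
  has_multiplicity f (dickson n a) 2 /\
  exists (alpha : {unit F}) (t : nat),
    f = dickson t a - (b ^+ t * (val alpha + (val alpha)^-1))%:P /\
    (0 < t)%N /\
    (t %| n %/ gcdn n (#|F| - 1))%N /\
    val alpha ^+ (n %/ t) = 1 /\
    (radn t %| #[alpha]%g)%N /\
    gcdn t ((#|F| - 1) %/ #[alpha]%g) = 1%N /\
    ~ (alpha = 1%g /\ t = 1%N).
Proof.
have b0 : b != 0 by apply: contraNneq ha => b0; rewrite -hb b0 expr0n.
move: hrad; rewrite -hb subn1; set q := #|F|; move=> hrad.
have q2 : (2.-nat q)%N := finField_card_pnat2 hchar.
have q_gt1 : (1 < q)%N := finNzRing_gt1 F.
have q1_gt0 : (0 < q.-1)%N by rewrite -subn1 subn_gt0.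
have q_gt0 : (0 < q)%N by apply: ltnW.
have odd_q1 : odd q.-1.
  rewrite -subn1 oddB // addbT -dvdn2.
  by case/p_natP: q2 q_gt1 => -[|e] -> // _; rewrite expnS dvdn_mulr.
have pr_n p : prime p -> (p %| n)%N -> (p %| q.-1)%N.
  by move=> p_pr p_n; apply: dvdn_trans hrad; apply: prime_dvd_radn.
have odd_n : odd n.
  apply: contraLR odd_q1; rewrite -!dvdn2; exact: pr_n.
pose k := n./2; have def_n : n = k.*2.+1.
  by rewrite -[n in LHS](odd_double_half n) odd_n.
have [L [iota _]] := countable_algebraic_closure F.
have char2L : 2%N \in [pchar L] by apply: (rmorph_pchar iota).
have ib0 : iota b != 0 by rewrite fmorph_eq0.
have [z prim_z] : exists z : L, n.-primitive_root z.
  apply: closed_prim_root.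
  by rewrite -(dvdn_pcharf char2L) dvdn2 odd_n.
have z0 : z != 0 by rewrite (prim_root_eq0 prim_z) -lt0n.
pose H := dickson_sqrt k b.
have def_D : dickson n (b ^+ 2) = 'X * H ^+ 2.
  by rewrite def_n dickson_odd_char2.
have prim_z' : k.*2.+1.-primitive_root z by rewrite -def_n.
have [uniq_rs def_H] := dickson_sqrt_roots char2L ib0 prim_z'.
have sep_H : separable_poly H.
  by rewrite -(separable_map iota) map_dickson_sqrt def_H separable_prod_XsubC.
(* A monic irreducible f dividing X would equal X. *)
have co_fX : coprimep f 'X.
  rewrite irreducible_poly_coprime //; apply/negP => f_X.
  case: hX; apply/eqP; rewrite -eqp_monic ?monicX // -dvdp_size_eqp //.
  have := dvdp_leq (monic_neq0 (monicX F)) f_X; rewrite size_polyX => le2.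
  by rewrite eqn_leq le2 hirr.1.
have f_H : f %| H.
  by move: hfact; rewrite -hb def_D Gauss_dvdpr // irreducible_dvdp_exp.
split; first by rewrite def_D; apply: multiplicity_X_sqr.
have [x f_x] : exists x, root (map_poly iota f) x.
  by apply/closed_rootP; rewrite size_map_poly gtn_eqF // hirr.1.
have H_x : root (map_poly iota H) x.
  move: f_x; rewrite -!dvdp_XsubCl => /dvdp_trans; apply.
  by rewrite dvdp_map.
move: H_x; rewrite map_dickson_sqrt def_H root_prod_XsubC => /mapP[i].
rewrite mem_iota add1n ltnS => /andP[i_gt0 le_ik] def_x.
set w := z ^+ i in def_x.
have w0 : w != 0 by rewrite expf_neq0.
have w_n : w ^+ n = 1 by rewrite exprAC (prim_expr_order prim_z) expr1n.
have w1 : w != 1.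
  rewrite -(prim_order_dvd prim_z) gtnNdvd // def_n ltnS (leq_trans le_ik) //.
  by rewrite -addnn leq_addl.
have [m prim_w m_n] := prim_order_exists hn w_n.
have odd_m : odd m by apply: dvdn_odd m_n odd_n.
have m_gt0 : (0 < m)%N := odd_gt0 odd_m.
have pr_m p : prime p -> (p %| m)%N -> (p %| q.-1)%N.
  by move=> p_pr p_m; apply: pr_n => //; apply: dvdn_trans m_n.
set g := gcdn m q.-1; set t := (m %/ g)%N.
have g_gt0 : (0 < g)%N by rewrite gcdn_gt0 m_gt0.
have def_m : (t * g)%N = m by rewrite divnK ?dvdn_gcdl.
have t_gt0 : (0 < t)%N by move: m_gt0; rewrite -def_m muln_gt0 => /andP[].
have t_m : (t %| m)%N by rewrite -def_m dvdn_mulr.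
have prim_wt : g.-primitive_root (w ^+ t).
  by apply: (dvdn_prim_root prim_w); apply: dvdn_gcdl.
(* The order g of w^t divides q - 1, so w^t is fixed by Frobenius and comes from F. *)
have [c def_c] : exists c : F, w ^+ t = iota c.
  apply: finField_image; rewrite -/q -(prednK q_gt0) exprS.
  have /eqP -> : w ^+ t ^+ q.-1 == 1.
    by rewrite -(prim_order_dvd prim_wt) dvdn_gcdr.
  by rewrite mulr1.
have c_unit : c \is a GRing.unit.
  by rewrite unitfE -(fmorph_eq0 iota) -def_c expf_neq0.
pose alpha := FinRing.Unit c_unit; exists alpha, t.
have ord_alpha : #[alpha]%g = g.
  by apply: (@order_unit_val _ _ iota); rewrite /= -def_c.
rewrite ord_alpha /=.
split.
  have [mon_D sz_D] := dickson_monic (b ^+ 2) t_gt0.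
  set E := dickson t _ - _.
  have lt_sz : (size (- (b ^+ t * (c + c^-1))%:P) < size (dickson t (b ^+ 2)))%N.
    by rewrite size_polyN sz_D (leq_ltn_trans (size_polyC_leq1 _)).
  have mon_E : E \is monic by rewrite monicE lead_coefDl.
  have sz_E : size E = t.+1 by rewrite size_polyDl.
  (* f and E share the root x; as both are monic, it remains to prove t <= deg f. *)
  have f_E : f %| E.
    apply: (@irreducible_dvdp_root _ _ iota _ _ x) => //.
    rewrite rootE rmorphB /= map_dickson map_polyC hornerD hornerN hornerC /=.
    rewrite rmorphXn def_x dickson_add_inv // def_c rmorphM rmorphXn rmorphD.
    by rewrite fmorphV subrr.
  apply/eqP; rewrite -eqp_monic // -dvdp_size_eqp // eqn_leq dvdp_leq ?monic_neq0 //=.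
  pose d := (size f).-1.
  have d_gt0 : (0 < d)%N by rewrite /d -subn1 subn_gt0 hirr.1.
  rewrite sz_E -(prednK (ltnW hirr.1)) ltnS -/d; apply: dvdn_leq => //.
  apply: (@dvdn_prim_root_degree L q d m (iota b) w) => //.
    by rewrite -rmorphXn expf_card.
  rewrite -def_x.
  have: root (map_poly iota ('X^(q ^ d) - 'X)) x.
    move: f_x; rewrite -!dvdp_XsubCl => /dvdp_trans; apply.
    by rewrite dvdp_map irreducible_dvdp_XcardX.
  by rewrite rmorphB /= map_polyXn map_polyX rootE !hornerE subr_eq0 => /eqP.
split=> //; split; first by apply: dvdn_div_gcd.
split.
  apply: (fmorph_inj iota); rewrite rmorphXn rmorph1 /= -def_c -exprM.
  by rewrite muln_divA ?(dvdn_trans t_m) // mulKn.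
split.
  (* A prime dividing t divides m, hence q - 1, hence g. *)
  apply: radn_dvd => p p_pr p_t; rewrite dvdn_gcd.
  have p_m := dvdn_trans p_t t_m.
  by rewrite p_m pr_m.
split; first by apply/eqP; apply: coprime_div_gcd.
(* For t = 1, alpha is w itself, and w differs from 1. *)
case=> /(congr1 val) /= c1 t1.
by move: w1; rewrite -[w]expr1 -t1 def_c c1 rmorph1 eqxx.
Qed.
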